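(* Let $(W,\Sigma)$ be a Coxeter system, $\pi\in W$, $Q$ a word in $W$ of size $n$, and $\Delta$ the subword complex $\Delta(Q,\pi)$. Let $k$ be a field. Assume that $G(I_{\Delta^\vee})=\{\mathbf x_{P_1},\ldots,\mathbf x_{P_r}\}$ with $\mathbf x_{P_1}>_{lex}\cdots>_{lex}\mathbf x_{P_r}$, $r\le n-\ell(\pi)+1$ and $d_r=r-1$, where $d_r=|\mathrm{set}(\mathbf x_{P_r})|$. Then the Stanley--Reisner ring $k[\Delta]$ is a complete intersection ring.
   Context: $\Sigma$ is the set of simple reflections of the Coxeter group $W$ and $\ell$ the length function. A word $Q=(\sigma_1,\ldots,\sigma_n)$ of size $n$ is an ordered sequence of elements of $\Sigma$; a subword $P=(\sigma_{i_1},\ldots,\sigma_{i_m})$, $i_1<\cdots<i_m$, is an ordered subsequence (identified with its set of positions $\{i_1,\ldots,i_m\}\subseteq\{1,\ldots,n\}$). $P$ represents $\pi$ if the ordered product of the simple reflections in $P$ is a reduced expression for $\pi$; $P$ contains $\pi$ if some subsequence of $P$ represents $\pi$. The subword complex $\Delta(Q,\pi)$ is the set of subwords $Q\setminus P$ such that $P$ contains $\pi$; it is a pure simplicial complex on (positions) $\{1,\ldots,n\}$ whose facets are the $Q\setminus P$ with $P$ representing $\pi$. For $P=(\sigma_{i_1},\ldots,\sigma_{i_m})$ put $\mathbf x_P=x_{i_1}\cdots x_{i_m}\in k[x_1,\ldots,x_n]$. The Stanley--Reisner ideal of the Alexander dual of $\Delta$ is $I_{\Delta^\vee}=(\mathbf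 x_P: P\subseteq Q,\ P\text{ represents }\pi)$, and $G(I_{\Delta^\vee})$ is its minimal monomial generating set (here $r\ge1$). The lexicographic order is taken with $x_1>\cdots>x_n$. With this ordering, $\mathrm{set}(\mathbf x_{P_i})=\{j\in\{1,\ldots,n\}: x_j\in(\mathbf x_{P_1},\ldots,\mathbf x_{P_{i-1}}):\mathbf x_{P_i}\}$. The Stanley--Reisner ring is $k[\Delta]=k[x_1,\ldots,x_n]/I_\Delta$ with $I_\Delta=(\prod_{i\in F}x_i: F\subseteq\{1,\ldots,n\},\ F\notin\Delta)$ (not every $i$ need be a vertex of $\Delta$). It is a complete intersection ring if $I_\Delta$ is generated by a regular sequence of $k[x_1,\ldots,x_n]$. *)

(* Defs.v *)
From mathcomp Require Export all_boot all_order all_algebra.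
From mathcomp Require Export boolp.
From mathcomp Require Export mpoly.

Set Implicit Arguments.
Unset Strict Implicit.
Unset Printing Implicit Defensive.

Import Order.TTheory GRing.Theory.

Section CoxeterGroups.
Local Open Scope group_scope.

Variables (W : groupType) (Sigma : {pred W}).

Definition word_product (s : seq W) : W := \prod_(x <- s) x.

(* [s] is an expression of [w] in the letters [Sigma]. *)
Definition expresses (s : seq W) (w : W) : Prop :=
  {subset s <= Sigma} /\ word_product s = w.

(* [W] is generated by the involutions in [Sigma] (so inverses of letters are
   not needed in words) and is presented by the relations (s t)^m(s,t) = 1,
   where m(s,t) is the order of s t in [W], with no relation if that order is
   infinite.  The presentation is expressed by its universal property; asking
   (f s * f t)^m = 1 for every exponent m with (s t)^m = 1 amounts to asking it
   for m = m(s,t), and s = t, m = 1 gives the relation s^2 = 1. *)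
Definition coxeter_system : Prop :=
  [/\ forall w : W, exists s : seq W, expresses s w,
      {in Sigma, forall s : W, s != 1 /\ s * s = 1}
    & forall (H : groupType) (f : W -> H),
        (forall (s t : W) (m : nat), s \in Sigma -> t \in Sigma ->
           (s * t) ^+ m = 1 -> (f s * f t) ^+ m = 1) ->
        exists phi : {multiplicative W -> H}, {in Sigma, forall s, phi s = f s}].

(* The junk value 0 is only taken outside the subgroup generated by [Sigma]. *)
Definition coxeter_length (w : W) : nat :=
  if pselect (exists l, `[< exists2 s, expresses s w & size s = l >])
  is left exl then ex_minn exl else 0.

Definition reduced_expression (s : seq W) (w : W) : Prop :=
  expresses s w /\ size s = coxeter_length w.

Variables (n : nat) (Q : n.-tuple W).

(* Subwords of [Q] are given by their sets of positions, numbered from 0;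
   [enum P] lists them in increasing order. *)
Definition subword (P : {set 'I_n}) : seq W := [seq tnth Q i | i <- enum P].

Definition represents (P : {set 'I_n}) (w : W) : Prop :=
  reduced_expression (subword P) w.

Definition contains (P : {set 'I_n}) (w : W) : Prop :=
  exists2 P' : {set 'I_n}, P' \subset P & represents P' w.

Definition subword_complex (w : W) : {set {set 'I_n}} :=
  [set F | `[< exists2 P : {set 'I_n}, contains P w & F = ~: P >]].

End CoxeterGroups.

Section Ideals.
Local Open Scope ring_scope.

Variable R : comNzRingType.

Definition ideal (s : seq R) (p : R) : Prop :=
  exists c : nat -> R, p = \sum_(i < size s) c i * s`_i.

Definition colon (I : R -> Prop) (f : R) (p : R) : Prop := I (p * f).

Definition regular_sequence (s : seq R) : Prop :=
  (forall i, (i < size s)%N -> forall p,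
     ideal (take i s) (p * s`_i) -> ideal (take i s) p)
  /\ ~ ideal s 1.

End Ideals.

Section StanleyReisner.
Local Open Scope ring_scope.

Variables (k : fieldType) (n : nat).

Implicit Types (Delta : {set {set 'I_n}}) (u v : seq 'X_{1..n}).

(* [mesym1 F] is the exponent vector of the product of the x_i, i in F. *)
Definition stanley_reisner_ideal Delta : {mpoly k[n]} -> Prop :=
  ideal [seq 'X_[k, mesym1 F] | F : {set 'I_n} in ~: Delta].

Definition alexander_dual Delta : {set {set 'I_n}} :=
  [set F : {set 'I_n} | ~: F \notin Delta].

Definition monomial_ideal u : {mpoly k[n]} -> Prop :=
  ideal [seq 'X_[k, m] | m <- u].

(* The monomials listed in [u] generate [I], and no proper subset does. *)
Definition minimal_monomial_generators (I : {mpoly k[n]} -> Prop) u : Prop :=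
  (forall p, I p <-> monomial_ideal u p) /\
  (forall v, {subset v <= u} -> (forall p, I p <-> monomial_ideal v p) ->
     {subset u <= v}).

(* The order on 'X_{1..n} in multinomials compares degrees first, so the pure
   lexicographic order on exponent vectors is used instead.  Its first
   component is the most significant: x_0 > x_1 > ... *)
Definition lex_gt (m m' : 'X_{1..n}) : bool :=
  ((multinom_val m' : n.-tuplelexi nat) < (multinom_val m : n.-tuplelexi nat))%O.

(* Indices start from 0: this is set(u_i) computed from u_0, ..., u_(i-1). *)
Definition linear_quotient_set u (i : nat) : {set 'I_n} :=
  [set j : 'I_n |
    `[< colon (monomial_ideal (take i u)) 'X_[k, nth 0%MM u i] 'X_j >]].

(* A property of k[Delta] = k[x_0, ..., x_(n-1)] / I_Delta, stated through its
   defining ideal: no quotient type is needed. *)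
Definition stanley_reisner_complete_intersection Delta : Prop :=
  exists2 s : seq {mpoly k[n]}, regular_sequence s &
    forall p, stanley_reisner_ideal Delta p <-> ideal s p.

End StanleyReisner.

Arguments stanley_reisner_ideal k {n} Delta p.
Arguments monomial_ideal k {n} u p.
Arguments linear_quotient_set k {n} u i.
Arguments stanley_reisner_complete_intersection k {n} Delta.

Section IdealGenerators.
Local Open Scope ring_scope.

Lemma ideal_mull (R : comNzRingType) (s : seq R) a x :
  x \in s -> ideal s (a * x).
Proof.
move=> /(nthP 0)[i lti <-]; exists (fun j => if j == i then a else 0).
rewrite (bigD1 (Ordinal lti)) //= eqxx big1 ?addr0 // => j nej.
by rewrite -val_eqE in nej; rewrite (negPf nej) mul0r.
Qed.

Lemma mem_ideal (R : comNzRingType) (s : seq R) x : x \in s -> ideal s x.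
Proof. by rewrite -[X in ideal s X]mul1r; apply: ideal_mull. Qed.

Lemma ideal_comb (R : comNzRingType) (s : seq R) (m : nat) (c g : nat -> R) :
  (forall i, (i < m)%N -> ideal s (g i)) -> ideal s (\sum_(i < m) c i * g i).
Proof.
elim: m => [|m IHm] gs.
  by exists (fun _ => 0); rewrite big_ord0 big1 // => i _; rewrite mul0r.
have [|a Ea] := IHm; first by move=> i lti; apply: gs; apply: ltnW.
have [b Eb] := gs m (ltnSn m); exists (fun i => a i + c m * b i).
rewrite big_ord_recr /= Ea Eb mulr_sumr -big_split /=.
by apply: eq_bigr => i _; rewrite mulrDl mulrA.
Qed.

Lemma ideal_sub (R : comNzRingType) (s t : seq R) :
  (forall x, x \in s -> ideal t x) -> forall p, ideal s p -> ideal t p.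
Proof.
move=> st _ [c ->]; apply: ideal_comb => i lti.
by apply: st; apply: mem_nth.
Qed.

(* The Stanley-Reisner ideal of the Alexander dual of the subword complex is
   generated by the monomials of the subwords representing [w]. *)
Lemma alexander_dual_idealE (W : groupType) (Sigma : {pred W}) (w : W)
    (n : nat) (Q : n.-tuple W) (k : fieldType) p :
  stanley_reisner_ideal k (alexander_dual (subword_complex Sigma Q w)) p <->
  ideal [seq 'X_[k, mesym1 P]
        | P : {set 'I_n} in [pred P | `[< represents Sigma Q P w >]]] p.
Proof.
have dualE F :
    F \in ~: alexander_dual (subword_complex Sigma Q w)
      = `[< contains Sigma Q F w >].
  rewrite !inE negbK; apply/asbool_equiv_eq; split.
    by case=> P cP /setC_inj ->.
  by exists F.
split; apply: ideal_sub => x /imageP[F FP ->].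
  move: FP; rewrite dualE => /asboolP[P sPF rP].
  have -> : 'X_[k, mesym1 F] = 'X_[mesym1 F - mesym1 P] * 'X_[mesym1 P].
    rewrite -mpolyXD submK //; apply/mnm_lepP => i; rewrite !mnmE.
    by case: (boolP (i \in P)) => // /(subsetP sPF) ->.
  by apply: ideal_mull; apply: image_f; apply/asboolP.
apply: mem_ideal; apply: image_f; rewrite dualE; apply/asboolP.
by exists F => //; move: FP => /asboolP.
Qed.

End IdealGenerators.

(* Main.v *)
(* Let A be the last of the subwords representing pi.  Since they all have the
   same size, |set(x_A)| = r - 1 forces every other one to be A - i + j for some
   j that determines it, and the lexicographic order gives j < i.

   Attach to a position i the reflection root(i) = u q_i u^-1, where u is the
   product of the letters of the subword before i.  Then A - i + j represents pi
   iff root(j) = root(i), and the universal property of W, applied to the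
   semidirect product of (Z/2)^W by W, shows that the set of roots of the letters
   of a reduced subword depends only on pi.  If A - i + j and A - i' + j' both
   represent pi with j < j', then root(j) is the root of some letter c of
   A - i' + j', so A - i' + j' - c + j represents pi too.  It is one of the
   A - i'' + j'' only if c = j', and then j determines i, so i = i'.  Thus all
   exchanges remove the same letter of A.

   Hence I_Delta is generated by the monomials x_i prod_j x_j, where i runs over
   A and j over the positions such that A - i + j represents pi; they have
   pairwise disjoint supports, so they form a regular sequence. *)
From HB Require Import structures.
Require Import Defs.

Set Implicit Arguments.
Unset Strict Implicit.
Unset Printing Implicit Defensive.

Import Order.TTheory GRing.Theory.

(** * The reflection cocycle and the Coxeter relations *)

Section ReflectionCocycle.
Local Open Scope group_scope.

Variable W : groupType.

(* The semidirect product of (Z/2)^W by W acting by conjugation. *)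
Definition wreath : Type := ((W -> bool) * W)%type.

HB.instance Definition _ := Choice.on wreath.

Definition wreath_mul (a b : wreath) : wreath :=
  (fun x => a.1 x (+) b.1 (a.2^-1 * x * a.2), a.2 * b.2).

Definition wreath_inv (a : wreath) : wreath :=
  (fun x => a.1 (a.2 * x * a.2^-1), a.2^-1).

Lemma wreath_eq (a b : wreath) : a.1 =1 b.1 -> a.2 = b.2 -> a = b.
Proof. by case: a b => [a u] [b v] /= /funext -> ->. Qed.

Lemma wreath_mulA : associative wreath_mul.
Proof.
move=> a b c; apply: wreath_eq => [x|] /=; last by rewrite mulgA.
by rewrite addbA invgM !mulgA.
Qed.

Lemma wreath_mul1 : left_id (((fun _ => false), 1) : wreath) wreath_mul.
Proof.
by move=> a; apply: wreath_eq => [x|] /=; rewrite ?invg1 ?mulg1 !mul1g.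
Qed.

Lemma wreath_mulr1 : right_id (((fun _ => false), 1) : wreath) wreath_mul.
Proof. by move=> a; apply: wreath_eq => [x|] /=; rewrite ?addbF ?mulg1. Qed.

Lemma wreath_mulV :
  left_inverse (((fun _ => false), 1) : wreath) wreath_inv wreath_mul.
Proof.
move=> a; apply: wreath_eq => [x|] /=; last by rewrite mulVg.
by rewrite invgK addbb.
Qed.

Lemma wreath_mulrV :
  right_inverse (((fun _ => false), 1) : wreath) wreath_inv wreath_mul.
Proof.
move=> a; apply: wreath_eq => [x|] /=; last by rewrite mulgV.
by rewrite !mulgA mulgV mul1g -mulgA mulgV mulg1 addbb.
Qed.

HB.instance Definition _ := isGroup.Build wreath
  wreath_mulA wreath_mul1 wreath_mulr1 wreath_mulV wreath_mulrV.

(** The indicator of [s] makes a product of such lifts record, modulo 2, the reflections met along a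
    word. *)
Definition wreath_refl (s : W) : wreath := (fun x => x == s, s).

(* The reflections met along the word s t s t ... of length 2m are the
   (s t)^i s, so if (s t)^m = 1 each is met an even number of times. *)
Lemma wreath_refl_expg (s t : W) (m : nat) : s * s = 1 -> t * t = 1 ->
  (wreath_refl s * wreath_refl t) ^+ m =
  ((fun x => \big[addb/false]_(i < m.*2) (x == (s * t) ^+ i * s)),
   (s * t) ^+ m) :> wreath.
Proof.
move=> ss tt; have sV := mulg1_eq ss; have tV := mulg1_eq tt.
set c := s * t; have sc j : s * c ^- j = c ^+ j * s.
  elim: j => [|j IHj]; first by rewrite invg1 mulg1 mul1g.
  rewrite [in LHS]expgS invgM mulgA IHj expgSr -!mulgA; congr (_ * _).
  by rewrite /c invgM sV tV !mulgA.
have conj_eq x y j : (c ^- j * x * c ^+ j == y) = (x == c ^+ j * y * c ^- j).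
  by rewrite -mulgA -(inj_eq (mulgI (c ^+ j))) mulVKg
             -(inj_eq (mulIg (c ^- j))) mulgK.
elim: m => [|m IHm].
  by apply: wreath_eq => [x|] //=; rewrite big_ord0.
rewrite expgSr IHm; apply: wreath_eq => [x|] /=; last by rewrite -/c expgSr.
rewrite doubleS !big_ord_recr /= -addbA; congr (_ (+) (_ (+) _)).
  by rewrite conj_eq -mulgA sc mulgA -expgnDr addnn.
have -> : s^-1 * (c ^- m * x * c ^+ m) * s = (s^-1 * c ^- m) * x * (c ^+ m * s).
  by rewrite !mulgA.
rewrite -invgM -mulgA -(inj_eq (mulgI (c ^+ m * s))) mulVKg.
rewrite -(inj_eq (mulIg (c ^+ m * s)^-1)) mulgK invgM sV.
by rewrite -addnn -addSn expgnDr expgSr -!mulgA -sc.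
Qed.

Lemma wreath_refl_relation (s t : W) (m : nat) : s * s = 1 -> t * t = 1 ->
  (s * t) ^+ m = 1 -> (wreath_refl s * wreath_refl t) ^+ m = 1 :> wreath.
Proof.
move=> ss tt stm; rewrite wreath_refl_expg // stm.
(* Since [(s * t) ^+ i] has period [m] in [i], the two halves of the sum cancel modulo 2. *)
apply: wreath_eq => [x|] //=; rewrite -addnn big_split_ord /=.
under [X in _ (+) X]eq_bigr => i _ do rewrite expgnDr stm mul1g.
by rewrite addbb.
Qed.

End ReflectionCocycle.

(** * Products and roots of words selected by a predicate on positions *)

Section PrefixProducts.
Local Open Scope group_scope.

Variables (W : groupType) (q : nat -> W).
Implicit Types P : pred nat.

Definition prefix_prod P m := \prod_(i < m | P i) q i.

(** Positions outside [P] have a root too: when letters are involutions, inserting the letter at [i]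
    multiplies the product on the left by it. *)
Definition prefix_root P i := prefix_prod P i * q i * (prefix_prod P i)^-1.

Definition toggle P i : pred nat := fun l => P l (+) (l == i).

Lemma prefix_prodS P m :
  prefix_prod P m.+1 = prefix_prod P m * (if P m then q m else 1).
Proof.
rewrite /prefix_prod big_mkcond big_ord_recr /=; congr (_ * _).
by rewrite [RHS]big_mkcond.
Qed.

Lemma eq_prefix_prod P P' m :
  (forall i, (i < m)%N -> P i = P' i) -> prefix_prod P m = prefix_prod P' m.
Proof. by move=> eqP; apply: eq_bigl => i; apply: eqP. Qed.

Lemma eq_prefix_root P P' m :
  (forall i, (i < m)%N -> P i = P' i) -> prefix_root P m = prefix_root P' m.
Proof. by move=> eqP; rewrite /prefix_root (eq_prefix_prod eqP). Qed.

Hypothesis qq : forall i, q i * q i = 1.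

Lemma prefix_root_sqr P i : prefix_root P i * prefix_root P i = 1.
Proof.
by rewrite /prefix_root !mulgA mulgVK -[_ * q i * q i]mulgA qq mulg1 mulgV.
Qed.

(* Inserting and deleting the letter at [i] are treated alike because letters
   are involutions. *)
Lemma prefix_prod_toggle P i m : prefix_prod (toggle P i) m =
  (if (i < m)%N then prefix_root P i else 1) * prefix_prod P m.
Proof.
elim: m => [|m IHm].
  by rewrite mul1g /prefix_prod !big_ord0.
rewrite !prefix_prodS {}IHm ltnS (leq_eqVlt i) /toggle /=.
have [<-|_] /= := eqVneq i m; last by rewrite addbF mulgA.
rewrite ltnn mul1g addbT /prefix_root; case: (P i) => /=.
  rewrite !mulgA mulgVK -!mulgA qq mulg1 //.
by rewrite mulg1 mulgVK.
Qed.

Lemma prefix_root_toggle P i j : prefix_root (toggle P i) j =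
  if (i < j)%N then prefix_root P i * prefix_root P j * prefix_root P i
  else prefix_root P j.
Proof.
rewrite {1}/prefix_root prefix_prod_toggle; case: ltnP => _; last by rewrite mul1g.
by rewrite invgM (mulg1_eq (prefix_root_sqr P i)) !mulgA.
Qed.

(** Conjugation by the involution [prefix_root P i] is injective and fixes that involution. *)
Lemma prefix_root_toggle_eq P i j :
  (prefix_root (toggle P i) j == prefix_root P i) =
  (prefix_root P j == prefix_root P i).
Proof.
rewrite prefix_root_toggle; case: ifP => // _.
have rr := prefix_root_sqr P i.
rewrite -[RHS](inj_eq (mulgI (prefix_root P i))).
by rewrite -[RHS](inj_eq (mulIg (prefix_root P i))) rr mul1g.
Qed.

(** The two toggles multiply the product on the left by two involutions, which cancel exactly when
    they are equal. *)
Lemma prefix_prod_toggle2 P i j m : (i < m)%N -> (j < m)%N ->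
  (prefix_prod (toggle (toggle P i) j) m == prefix_prod P m) =
  (prefix_root P j == prefix_root P i).
Proof.
move=> lim ljm; rewrite !prefix_prod_toggle lim ljm mulgA.
rewrite -[X in _ == X]mul1g (inj_eq (mulIg _)) -(prefix_root_sqr P i).
by rewrite (inj_eq (mulIg _)) prefix_root_toggle_eq.
Qed.

Variable Sigma : {pred W}.
Hypothesis coxW : coxeter_system Sigma.

(** The universal property extends [wreath_refl] to a morphism [phi] on [W]. The first component of
    [phi] at a product counts the roots of the word modulo 2, while [phi] sees only the product. *)
Lemma root_parity m P P' t : (forall i, (i < m)%N -> q i \in Sigma) ->
  prefix_prod P m = prefix_prod P' m ->
  \big[addb/false]_(i < m | P i) (prefix_root P i == t) =
  \big[addb/false]_(i < m | P' i) (prefix_root P' i == t).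
Proof.
move=> Sq eqw; have [_ invol univ] := coxW.
have [|phi phiE] := univ (wreath W) (@wreath_refl W).
  move=> s t' k Ss St; apply: wreath_refl_relation.
    by have [] := invol s Ss.
  by have [] := invol t' St.
have phi1 : phi 1 = 1 by apply: (mulgI (phi 1)); rewrite -gmulfM !mulg1.
suff key S : phi (prefix_prod S m) =
    (fun x => \big[addb/false]_(i < m | S i) (prefix_root S i == x),
     prefix_prod S m).
  have /(congr1 (fun a : wreath W => a.1 t)) := key P.
  by rewrite eqw key /= => ->.
elim: m Sq {eqw} => [|m IHm] Sq.
  rewrite /prefix_prod big_ord0 phi1; apply: wreath_eq => //= x.
  by rewrite big_ord0.
rewrite prefix_prodS gmulfM IHm; last by move=> i /ltnW; apply: Sq.
apply: wreath_eq => [x|]; last by case: ifP; rewrite ?phi1 // phiE ?Sq.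
rewrite /= [RHS]big_mkcond big_ord_recr /= -big_mkcond /=; congr (_ (+) _).
case: ifP; rewrite ?phi1 // phiE ?Sq //= => _.
rewrite -[LHS](inj_eq (mulgI (prefix_prod S m))) -mulgA mulVKg.
by rewrite -(inj_eq (mulIg (prefix_prod S m)^-1)) mulgK eq_sym.
Qed.

End PrefixProducts.

(** * Exchanges in reduced subwords *)

Section Subwords.
Local Open Scope group_scope.

Variables (W : groupType) (Sigma : {pred W}) (n : nat) (Q : n.-tuple W).
Hypothesis coxW : coxeter_system Sigma.
Hypothesis QS : {subset Q <= Sigma}.
Implicit Types (P : {set 'I_n}) (i j : 'I_n).

(** Extended by [false] beyond [n], so that the results on predicates over [nat] apply. *)
Definition nat_pred_of_set P : pred nat := fun l => oapp (mem P) false (insub l).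

Definition root P i := prefix_root (nth 1 Q) (nat_pred_of_set P) i.

Definition flip P i := [set l | (l \in P) (+) (l == i)].

Lemma nat_pred_of_setE P i : nat_pred_of_set P i = (i \in P).
Proof. by rewrite /nat_pred_of_set valK. Qed.

Lemma word_product_subword P : word_product (subword Q P) =
  prefix_prod (nth 1 Q) (nat_pred_of_set P) n.
Proof.
rewrite /word_product /subword big_map -deprecated_filter_index_enum big_filter.
by apply: eq_big => i; rewrite ?nat_pred_of_setE // (tnth_nth 1).
Qed.

Lemma nth_letter_sqr l : nth 1 Q l * nth 1 Q l = 1.
Proof.
(* Past the end of [Q] the default letter is 1, whose square is also 1. *)
case: (ltnP l (size Q)) => [ltl | lel]; last by rewrite nth_default ?mulg1.
have [_ invol _] := coxW; have [] // := invol (nth 1 Q l).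
exact/QS/mem_nth.
Qed.

Lemma nat_pred_of_set_flip P i l : (l < n)%N ->
  nat_pred_of_set (flip P i) l = toggle (nat_pred_of_set P) i l.
Proof.
by move=> ltl; rewrite /toggle -[l]/(val (Ordinal ltl)) !nat_pred_of_setE !inE.
Qed.

Lemma flip2E P i j : i \in P -> j \notin P ->
  flip (flip P i) j = j |: P :\ i.
Proof.
move=> Pi Pj; apply/setP=> l; rewrite !inE; have [->|] := eqVneq l j.
  by rewrite (negPf Pj); case: eqVneq Pj => //= ->; rewrite Pi.
by have [->|] := eqVneq l i; rewrite ?Pi ?addbF //=; case: (_ \in P).
Qed.

Lemma word_product_flip2 P i j :
  (word_product (subword Q (flip (flip P i) j)) == word_product (subword Q P)) =
  (root P j == root P i).
Proof.
rewrite /root -(prefix_prod_toggle2 nth_letter_sqr _ (ltn_ord i) (ltn_ord j)).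
rewrite !word_product_subword; congr (_ == _); apply: eq_prefix_prod => l ltl.
by rewrite nat_pred_of_set_flip // /toggle nat_pred_of_set_flip.
Qed.

Lemma subword_root_parity P P' t :
  word_product (subword Q P) = word_product (subword Q P') ->
  \big[addb/false]_(i in P) (root P i == t) =
  \big[addb/false]_(i in P') (root P' i == t).
Proof.
rewrite !word_product_subword => /(@root_parity _ _ _ coxW) eqt.
under eq_bigl => i do rewrite -nat_pred_of_setE.
rewrite eqt; last by move=> i lti; apply/QS/mem_nth; rewrite size_tuple.
by apply: eq_bigl => i; rewrite nat_pred_of_setE.
Qed.

Lemma eq_root P P' j :
  (forall i, (i < j)%N -> (i \in P) = (i \in P')) -> root P j = root P' j.
Proof.
move=> eqPP'; apply: eq_prefix_root => l ltlj.
have ltl := ltn_trans ltlj (ltn_ord j).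
by rewrite -[l]/(val (Ordinal ltl)) !nat_pred_of_setE eqPP'.
Qed.

Variable w : W.

Lemma subword_expresses P :
  word_product (subword Q P) = w -> expresses Sigma (subword Q P) w.
Proof. by split=> // _ /mapP[i _ ->]; apply/QS/mem_tnth. Qed.

Lemma coxeter_length_le s : expresses Sigma s w ->
  (coxeter_length Sigma w <= size s)%N.
Proof.
move=> ws; rewrite /coxeter_length; case: pselect => // exl.
by case: ex_minnP => l _; apply; apply/asboolP; exists s.
Qed.

Lemma representsP P : represents Sigma Q P w <->
  word_product (subword Q P) = w /\ #|P| = coxeter_length Sigma w.
Proof.
rewrite /represents /reduced_expression size_map -cardE.
by split=> [[[_ ->]]|[/subword_expresses]].
Qed.

Lemma represents_card P P' :
  represents Sigma Q P w -> represents Sigma Q P' w -> #|P| = #|P'|.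
Proof. by move=> /representsP[_ ->] /representsP[_ ->]. Qed.

(** The exchange is a double flip, which keeps the product exactly when the roots agree; it also
    keeps the size, hence reducedness. *)
Lemma represents_exchange P i j : represents Sigma Q P w ->
  i \in P -> j \notin P ->
  represents Sigma Q (j |: P :\ i) w <-> root P j = root P i.
Proof.
move=> rP Pi Pj; have [wP cP] := (representsP P).1 rP.
rewrite representsP -(flip2E Pi Pj); split=> [[wF _]|/eqP].
  by apply/eqP; rewrite -word_product_flip2 wF wP.
rewrite -word_product_flip2 wP => /eqP; split=> //; rewrite -cP flip2E //.
by rewrite cardsU1 !inE (negPf Pj) andbF (cardsD1 i P) Pi.
Qed.

(** Deleting two letters with the same root would leave a shorter expression of [w]. *)
Lemma represents_root_inj P : represents Sigma Q P w -> {in P &, injective (root P)}.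
Proof.
move=> /representsP[wP cP] i j Pi Pj /eqP; apply: contraTeq => neij.
rewrite eq_sym -word_product_flip2 wP; apply/eqP => /subword_expresses.
move=> /coxeter_length_le; rewrite size_map -cardE -cP; apply/negP; rewrite -ltnNge.
apply: proper_card; apply/properP; split.
  apply/subsetP => l; rewrite !inE; have [->|_] := eqVneq l i; first by [].
  by have [->|_] := eqVneq l j; rewrite ?Pj // !addbF.
by exists i; rewrite // !inE Pi eqxx (negPf neij).
Qed.

(* The parity of the number of letters with a given root depends only on [w],
   and it is odd for [root P i], which occurs just once in the reduced [P]. *)
Lemma represents_root_transfer P P' i :
  represents Sigma Q P w -> represents Sigma Q P' w -> i \in P ->
  exists2 c, c \in P' & root P' c = root P i.
Proof.
move=> rP rP' Pi.
suff /exists_inP[c P'c /eqP rc] : [exists c in P', root P' c == root P i].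
  by exists c.
apply: contraT => /exists_inPn noc.
have [wP _] := (representsP P).1 rP; have [wP' _] := (representsP P').1 rP'.
have /esym := @subword_root_parity P P' (root P i) (etrans wP (esym wP')).
rewrite big1 => [|c /noc /negPf //].
rewrite (bigD1 i) //= eqxx big1 // => l /andP[Pl]; apply: contraNF => /eqP.
by move/(represents_root_inj rP Pl Pi)->.
Qed.

Lemma represents_two_exchanges P i j i' j' : represents Sigma Q P w ->
  i \in P -> i' \in P -> j \notin P -> j' \notin P ->
  (j < j')%N -> (j' < i')%N ->
  represents Sigma Q (j |: P :\ i) w ->
  represents Sigma Q (j' |: P :\ i') w ->
  represents Sigma Q (j |: P :\ i') w \/
  exists2 P', represents Sigma Q P' w & (j \in P') && (j' \in P').
Proof.
move=> rP Pi Pi' Pj Pj' ltjj' ltj'i' /(represents_exchange rP Pi Pj) eqr rP'.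
have [c cP' rc] := represents_root_transfer rP rP' Pi.
have jP' : j \notin j' |: P :\ i'.
  by rewrite !inE (negPf Pj) andbF orbF neq_ltn ltjj'.
(* Both [j'] and [i'] lie after [j], so the second exchange does not change the root of [j]. *)
have rj : root (j' |: P :\ i') j = root (j' |: P :\ i') c.
  rewrite rc -eqr; apply: eq_root => l ltlj; have ltlj' := ltn_trans ltlj ltjj'.
  have [lj' li'] : l != j' /\ l != i'.
    by rewrite !neq_ltn ltlj' (ltn_trans ltlj' ltj'i').
  by rewrite !inE (negPf lj') li'.
have := (represents_exchange rP' cP' jP').2 rj.
(* If [c] is [j'], removing it undoes the insertion of [j'] and gives the first alternative;
   otherwise [j'] survives next to [j]. *)
have [->|ncj'] := eqVneq c j'; last first.
  by right; exists (j |: (j' |: P :\ i') :\ c); rewrite // !inE !eqxx [j' == c]eq_sym ncj' orbT.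
by rewrite setU1K ?inE ?(negPf Pj') ?andbF //; left.
Qed.

End Subwords.

(** * Monomial ideals and regular sequences of monomials *)

Section MonomialIdeals.
Local Open Scope ring_scope.

Variables (k : fieldType) (n : nat).
Implicit Types (p : {mpoly k[n]}) (u : seq 'X_{1..n}) (S T : {set 'I_n}).

Lemma mesym1_le S T : (mesym1 S <= mesym1 T)%MM = (S \subset T).
Proof.
apply/mnm_lepP/subsetP => [le i Si|sST i].
  by have := le i; rewrite !mnmE Si; case: (i \in T).
by rewrite !mnmE; case: (boolP (i \in S)) => // /sST ->.
Qed.

Lemma monomial_ideal_dvd u m m' :
  m' \in u -> (m' <= m)%MM -> monomial_ideal k u 'X_[m].
Proof.
move=> um' le; rewrite -(submK le) mpolyXD; apply: ideal_mull.
exact: map_f.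
Qed.

Lemma monomial_idealP u p : monomial_ideal k u p <->
  forall m, m \in msupp p -> exists2 m', m' \in u & (m' <= m)%MM.
Proof.
split=> [[c ->] m|mp].
  rewrite mcoeff_msupp raddf_sum /= => nz.
  apply/hasP; apply: contraNT nz => /hasPn nou.
  rewrite big1 // => i _; apply: memN_msupp_eq0.
  have lti : (i < size u)%N by rewrite -(size_map (fun m => 'X_[k, m])) ltn_ord.
  rewrite (nth_map 0%MM) // (perm_mem (msuppMX _ _)).
  apply/mapP=> -[m' _ Em]; have /negP := nou _ (mem_nth 0%MM lti); apply.
  by rewrite Em lem_addr.
rewrite (mpolyE p) (big_nth 0%MM) big_mkord.
under eq_bigr => i _ do rewrite -mul_mpolyC.
apply: (@ideal_comb _ _ _ (fun i => (p@_(nth 0%MM (msupp p) i))%:MP)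
  (fun i => 'X_[nth 0%MM (msupp p) i])) => i lti.
have [m' um' le] := mp _ (mem_nth 0%MM lti).
exact: monomial_ideal_dvd um' le.
Qed.

Lemma monomial_idealX u m : monomial_ideal k u 'X_[m] <->
  exists2 m', m' \in u & (m' <= m)%MM.
Proof.
rewrite monomial_idealP; split=> [|ex m']; first by apply; rewrite msuppX mem_head.
by rewrite msuppX inE => /eqP ->.
Qed.

(** If a squarefree monomial divides the product of [m] and a monomial of disjoint support, it
    divides [m]. Excluding [set0] keeps 1 out of the ideal. *)
Lemma disjoint_monomials_regular (s : seq {set 'I_n}) :
  set0 \notin s -> pairwise (fun S T => [disjoint S & T]) s ->
  regular_sequence [seq 'X_[k, mesym1 T] | T <- s].
Proof.
rewrite (map_comp (fun m => 'X_[k, m])); move=> s0 disj; split=> [i|].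
  rewrite !size_map => lti p; rewrite -map_take.
  rewrite (nth_map 0%MM) ?size_map // (nth_map set0) // -map_take.
  move=> /monomial_idealP div; apply/monomial_idealP => m pm.
  have [|_ /mapP[T Ts ->] /mnm_lepP le] := div (mesym1 (nth set0 s i) + m)%MM.
    by rewrite (perm_mem (msuppMX _ _)) map_f.
  exists (mesym1 T); first exact: map_f.
  have [j ltj Ej] := nthP set0 Ts; move: ltj; rewrite size_take lti => ltji.
  rewrite nth_take // in Ej; have := pairwiseP set0 disj _ _ _ _ ltji.
  rewrite !inE lti (ltn_trans ltji lti) Ej => /(_ isT isT) dT.
  apply/mnm_lepP => l; have := le l; rewrite !mnmE.
  by have [Tl|//] := boolP (l \in T); rewrite (disjointFr dT Tl).
move=> /monomial_idealP/(_ 0%MM); rewrite msupp1 mem_head.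
case=> // _ /mapP[T sT ->]; rewrite -mesym1_set0 mesym1_le subset0 => /eqP T0.
by rewrite -T0 sT in s0.
Qed.

End MonomialIdeals.

(** * Subword complexes whose representing subwords are all exchanges of one subword *)

Section ExchangesFromOneSubword.

Variables (W : groupType) (Sigma : {pred W}) (n : nat) (Q : n.-tuple W).
Hypothesis coxW : coxeter_system Sigma.
Hypothesis QS : {subset Q <= Sigma}.
Variables (w : W) (A : {set 'I_n}).
Implicit Types (B P F : {set 'I_n}) (i j : 'I_n).

Local Notation repr P := (represents Sigma Q P w).

Hypothesis reprA : repr A.
Hypothesis repr_near : forall P, repr P -> P != A -> exists j, P :\: A = [set j].
Hypothesis repr_near_inj : forall P P', repr P -> repr P' -> P != A -> P' != A ->
  P :\: A = P' :\: A -> P = P'.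
Hypothesis repr_near_lt : forall i j, i \in A -> j \notin A ->
  repr (j |: A :\ i) -> j < i.

Lemma exchangeD i j : j \notin A -> (j |: A :\ i) :\: A = [set j].
Proof.
move=> Aj; apply/setP=> l; rewrite !inE; have [->|_] /= := eqVneq l j.
  by rewrite Aj.
by rewrite andbCA andNb andbF.
Qed.

Lemma exchange_neq i j : j \notin A -> j |: A :\ i != A.
Proof. by apply: contraNneq => <-; rewrite !inE eqxx. Qed.

Lemma exchange_inj i i' j : i \in A -> i' \in A -> j \notin A ->
  repr (j |: A :\ i) -> repr (j |: A :\ i') -> i = i'.
Proof.
move=> Ai Ai' Aj ri ri'.
have /setP/(_ i) : j |: A :\ i = j |: A :\ i'.
  by apply: repr_near_inj; rewrite ?exchange_neq // !exchangeD.
rewrite !inE eqxx Ai; have [ij|_] := eqVneq i j; first by rewrite -ij Ai in Aj.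
by case: eqVneq.
Qed.

(** For [j < j'], the second outcome of [represents_two_exchanges] would put two positions outside
    [A] into one representing subword; in the first, [j] determines the removed letter. *)
Lemma exchanged_unique i i' j j' : i \in A -> i' \in A ->
  j \notin A -> j' \notin A ->
  repr (j |: A :\ i) -> repr (j' |: A :\ i') -> i = i'.
Proof.
wlog lejj' : i i' j j' / j <= j'.
  move=> wl; case: (leqP j j') => [|/ltnW]; first exact: wl.
  by move=> lej'j Ai Ai' Aj Aj' ri ri'; apply/esym; apply: wl lej'j _ _ _ _ ri' ri.
move=> Ai Ai' Aj Aj' ri ri'; move: lejj'; rewrite leq_eqVlt.
case/predU1P => [/val_inj jj'|ltjj'].
  by move: ri'; rewrite -jj'; apply: exchange_inj.
have [|[P rP /andP[Pj Pj']]] := represents_two_exchanges coxW QS reprA Ai Ai'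
    Aj Aj' ltjj' (repr_near_lt Ai' Aj' ri') ri ri'.
  exact: exchange_inj.
have [|l /setP El] := repr_near rP; first by apply: contraNneq Aj => <-.
have := El j; have := El j'; rewrite !inE Aj Aj' Pj Pj' => /esym/eqP <- /esym/eqP Ej.
by rewrite Ej ltnn in ltjj'.
Qed.

(** Since [P] and [A] have equal size, [A :\: P] is a singleton like [P :\: A]. *)
Lemma exchange_of_repr P : repr P -> P != A ->
  exists i j, [/\ i \in A, j \notin A & P = j |: A :\ i].
Proof.
move=> rP PA; have [j PDA] := repr_near rP PA.
have cPA := represents_card QS rP reprA.
have /eqP/cards1P[i ADP] : #|A :\: P| = 1.
  apply: (@addnI #|A :&: P|).
  by rewrite cardsID -cPA -(cardsID A P) PDA cards1 setIC.
have in_A l : (l \in A) && (l \notin P) = (l == i).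
  by have /setP/(_ l) := ADP; rewrite !inE andbC.
have in_P l : (l \in P) && (l \notin A) = (l == j).
  by have /setP/(_ l) := PDA; rewrite !inE andbC.
exists i, j; split.
- by have := in_A i; rewrite eqxx => /andP[].
- by have := in_P j; rewrite eqxx => /andP[].
apply/setP=> l; rewrite !inE -in_A -in_P.
by case: (l \in A); case: (l \in P).
Qed.

Definition exchangers i := [set j | (j \notin A) && `[< repr (j |: A :\ i) >]].

(** Supports of the generators of the Stanley-Reisner ideal. By [exchanged_unique], at most one of
    them is not a singleton. *)
Definition generators := [seq i |: exchangers i | i <- enum A].

Lemma generators_disjoint :
  pairwise (fun S T : {set 'I_n} => [disjoint S & T]) generators.
Proof.
rewrite pairwise_map.
apply: (sub_in_pairwise (P := mem A) (r := [rel i i' | i != i'])).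
- move=> i i' /= Ai Ai' neii'; rewrite -setI_eq0; apply/eqP/setP=> l.
  rewrite !inE; apply/negP => /andP[].
  case/predU1P => [->|/andP[Al /asboolP rl]].
    by case/predU1P => [ii'|/andP[/negP]]; rewrite ?ii' ?eqxx in neii' *.
  case/predU1P => [li'|/andP[_ /asboolP rl']]; first by rewrite li' Ai' in Al.
  by rewrite (exchange_inj Ai Ai' Al rl rl') eqxx in neii'.
- by apply/allP => i; rewrite mem_enum.
- by rewrite -uniq_pairwise enum_uniq.
Qed.

Lemma notin_subword_complexP F : F \notin subword_complex Sigma Q w <->
  forall P, repr P -> exists2 l, l \in P & l \in F.
Proof.
rewrite inE; split=> [/asboolPn nF P rP|meet].
  suff /exists_inP[l Pl Fl] : [exists l in P, l \in F] by exists l.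
  apply/contraT => /exists_inPn PF; case: nF; exists (~: F); rewrite ?setCK //.
  by exists P => //; apply/subsetP => l /PF; rewrite inE.
apply/asboolPn => -[S [P sP rP] EF]; have [l Pl] := meet P rP.
by rewrite EF inE (subsetP sP).
Qed.

(** A representing subword either keeps [i] or has replaced [i] by one of its exchangers. *)
Lemma generators_nonface T :
  T \in generators -> T \notin subword_complex Sigma Q w.
Proof.
case/mapP => i; rewrite mem_enum => Ai ->; apply/notin_subword_complexP => P rP.
have [->|PA] := eqVneq P A; first by exists i; rewrite // !inE eqxx.
have [i' [j [Ai' Aj EP]]] := exchange_of_repr rP PA.
have [ii'|neii'] := eqVneq i i'.
  exists j; first by rewrite EP !inE eqxx.
  by rewrite !inE Aj; apply/orP; right; apply/asboolP; rewrite ii' -EP.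
by exists i; rewrite ?EP !inE ?eqxx // Ai neii' orbT.
Qed.

(* If [F] contains no generator, it misses an exchanger of some [i] in [A] and
   hence meets [A] again at some [i'], of which it misses an exchanger too. *)
Lemma nonface_generators F : F \notin subword_complex Sigma Q w ->
  exists2 T, T \in generators & T \subset F.
Proof.
move/notin_subword_complexP => meet.
have gen i : i \in A -> i |: exchangers i \in generators.
  by move=> Ai; apply/map_f; rewrite mem_enum.
have missed i : i \in A -> i \in F -> ~~ (i |: exchangers i \subset F) ->
    exists2 j, j \notin A & repr (j |: A :\ i) /\ j \notin F.
  move=> Ai Fi; rewrite subUset sub1set Fi => /subsetPn[j].
  by rewrite inE => /andP[Aj /asboolP rj] Fj; exists j.
have [i Ai Fi] := meet A reprA.
have [|/(missed _ Ai Fi)[j Aj [rj Fj]]] := boolP (i |: exchangers i \subset F).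
  by exists (i |: exchangers i); rewrite ?gen.
have [i' + Fi'] := meet _ rj; rewrite !inE.
case/predU1P => [Ei'|/andP[nei'i Ai']]; first by rewrite -Ei' Fi' in Fj.
have [|/(missed _ Ai' Fi')[j' Aj' [rj' _]]] := boolP (i' |: exchangers i' \subset F).
  by exists (i' |: exchangers i'); rewrite ?gen.
by rewrite (exchanged_unique Ai' Ai Aj' Aj rj' rj) eqxx in nei'i.
Qed.

Lemma complete_intersection_of_exchanges (k : fieldType) :
  stanley_reisner_complete_intersection k (subword_complex Sigma Q w).
Proof.
exists [seq 'X_[k, mesym1 T] | T <- generators].
  apply: disjoint_monomials_regular generators_disjoint.
  by apply/mapP => -[i _ /setP/(_ i)]; rewrite !inE eqxx.
move=> p; rewrite (map_comp (fun m => 'X_[k, m])).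
split; apply: ideal_sub => x.
  case/imageP => F; rewrite inE => /nonface_generators[T gT sTF] ->.
  by apply: (@monomial_ideal_dvd _ _ _ _ (mesym1 T)); rewrite ?map_f ?mesym1_le.
rewrite -map_comp => /mapP[T /generators_nonface FT ->].
by apply/mem_ideal/image_f; rewrite inE.
Qed.

End ExchangesFromOneSubword.

(** * Minimal generators of the ideal of the Alexander dual *)

Section MinimalGenerators.

Variables (W : groupType) (Sigma : {pred W}) (n : nat) (Q : n.-tuple W).
Hypothesis QS : {subset Q <= Sigma}.
Variables (w : W) (k : fieldType) (s : seq {set 'I_n}).

(** Two generating sets of one monomial ideal divide each other: [P' \subset S \subset P] with [P]
    and [P'] representing [w] forces equality, as these have the same size. Minimality gives the
    converse. *)
Lemma minimal_generators_represents :
  minimal_monomial_generators (stanley_reisner_ideal k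
    (alexander_dual (subword_complex Sigma Q w))) [seq mesym1 P | P <- s] ->
  forall P, P \in s <-> represents Sigma Q P w.
Proof.
pose reps := [seq mesym1 P
  | P : {set 'I_n} in [pred P | `[< represents Sigma Q P w >]]].
have repsP P : represents Sigma Q P w -> mesym1 P \in reps.
  by move=> rP; apply/image_f/asboolP.
case=> genE gen_min.
have idealE p : monomial_ideal k reps p <-> monomial_ideal k [seq mesym1 P | P <- s] p.
  by rewrite -genE alexander_dual_idealE /monomial_ideal /reps -map_comp.
have rs P : represents Sigma Q P w -> P \in s.
  move=> rP; have /idealE/monomial_idealX : monomial_ideal k reps 'X_[mesym1 P].
    by apply/mem_ideal/map_f/repsP.
  case=> _ /mapP[S sS ->]; rewrite mesym1_le => sSP.
  have : monomial_ideal k [seq mesym1 P | P <- s] 'X_[mesym1 S].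
    by apply/mem_ideal/map_f/map_f.
  move=> /idealE/monomial_idealX[_ /imageP[P' /asboolP rP' ->]].
  rewrite mesym1_le => sP'S.
  have /eqP P'P : P' == P.
    by rewrite eqEcard (subset_trans sP'S sSP) (represents_card QS rP rP') leqnn.
  by have /eqP <- : S == P by rewrite eqEsubset sSP -P'P sP'S.
move=> P; split=> [sP|]; last exact: rs.
have /(_ (mesym1 P)) : {subset [seq mesym1 P | P <- s] <= reps}.
  apply: gen_min => [m /imageP[P' /asboolP rP' ->]|p].
    by apply/map_f/rs.
  by rewrite genE idealE.
by move/(_ (map_f _ sP)) => /imageP[P' /asboolP rP' /inj_mesym1 ->].
Qed.

End MinimalGenerators.

(** * The lexicographic order on exchanges, and the conclusion *)

Lemma lex_gt_irr n : irreflexive (@lex_gt n).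
Proof. by move=> m; rewrite /lex_gt ltxx. Qed.

Lemma lex_gt_trans n : transitive (@lex_gt n).
Proof. by move=> m1 m2 m3 lt12 lt13; apply: lt_trans lt13 lt12. Qed.

(** The first difference between the exponent vectors is a position gained over [A], so it is [j],
    and [i], where they also differ, comes later. *)
Lemma lex_gt_exchange n (A : {set 'I_n}) (i j : 'I_n) :
  i \in A -> j \notin A ->
  lex_gt (mesym1 (j |: A :\ i)) (mesym1 A) -> j < i.
Proof.
move=> Ai Aj /ltxi_tuplePlt[l eql lt_l].
have tE (P : {set 'I_n}) l' : tnth (multinom_val (mesym1 P)) l' = (l' \in P).
  by rewrite -[LHS]/(mesym1 P l') mnmE.
have Al : l \in A = false.
  by move: lt_l; rewrite !tE ltEnat; case: (l \in A) => //; case: (l \in _).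
have {lt_l} lj : l = j.
  by apply/eqP; move: lt_l; rewrite !tE !inE Al andbF orbF; case: eqVneq.
have neij : i != j by apply: contraNneq Aj => <-.
have neji : j != i :> nat by rewrite eq_sym.
rewrite ltn_neqAle neji leqNgt; apply/negP; rewrite -lj => ltil.
have := eql i ltil; by rewrite !tE !inE Ai eqxx (negPf neij).
Qed.

Lemma uniq_map_in_inj (T U : eqType) (f : T -> U) (s : seq T) :
  uniq (map f s) -> {in s &, injective f}.
Proof.
move=> Uf x y xs ys eqf; rewrite -(nth_index x xs) -(nth_index x ys).
congr nth; apply: (uniqP (f x) Uf); rewrite ?inE ?size_map ?index_mem //.
by rewrite !(nth_map x) ?index_mem // !nth_index.
Qed.

Theorem proposition4p2p10 (W : groupType) (Sigma : {pred W}) (pi : W)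
    (n : nat) (Q : n.-tuple W) (k : fieldType)
    (r : nat) (P : r.-tuple {set 'I_n}) :
  coxeter_system Sigma ->
  {subset Q <= Sigma} ->
  (1 <= r)%N ->
  let Delta := subword_complex Sigma Q pi in
  let x := [seq mesym1 p | p <- P] in
  minimal_monomial_generators
    (stanley_reisner_ideal k (alexander_dual Delta)) x ->
  sorted (@lex_gt n) x ->
  (r + coxeter_length Sigma pi <= n + 1)%N ->
  #|linear_quotient_set k x (r - 1)| = (r - 1)%N ->
  stanley_reisner_complete_intersection k Delta.
Proof.
(* From here on [r] is one less than in the statement, so [r] is the index of the last generator. *)
move=> coxW QS; case: r P => // r P _ Delta x gens x_sorted _.
rewrite subn1 /=; set D := linear_quotient_set _ _ _ => cardD.
have reprP S : S \in P <-> represents Sigma Q S pi.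
  exact: minimal_generators_represents gens S.
have szP : size P = r.+1 by rewrite size_tuple.
have uniqP : uniq P.
  apply: (@map_uniq _ _ (@mesym1 n)).
  exact: sorted_uniq (@lex_gt_trans n) (@lex_gt_irr n) _ x_sorted.
pose A := nth set0 P r; pose s := take r P.
have PE : tval P = rcons s A by rewrite -take_nth ?take_oversize ?szP.
have PA : A \in P by apply: mem_nth; rewrite szP.
have reprA := (reprP A).1 PA.
have szs : size s = r by rewrite size_take szP ltnSn.
have sP S : (S \in s) = (S \in P) && (S != A).
  move: uniqP; rewrite -[S \in P]/(S \in tval P) PE rcons_uniq mem_rcons inE => /andP[As _].
  by have [->|_] := eqVneq S A; rewrite ?andbT //= (negPf As).
(* If [x_j] lies in the colon ideal, some earlier [S] divides [x_j] times the monomial of [A], so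
   [S :\: A] is inside [[set j]]; it is nonempty because [S] differs from [A] and has the same
   size. *)
have diffs_sub : {subset [seq [set j] | j <- enum D] <= [seq B :\: A | B <- s]}.
  move=> _ /mapP[j + ->]; rewrite mem_enum inE => /asboolP.
  rewrite /colon -mpolyXD -map_take -/s (nth_map set0) ?szP // -/A.
  case/monomial_idealX=> _ /mapP[S sS ->] /mnm_lepP le; apply/mapP; exists S => //.
  move: sS; rewrite sP => /andP[PS neSA].
  have SDA : S :\: A \subset [set j].
    apply/subsetP=> l; rewrite !inE => /andP[Al Sl].
    by have := le l; rewrite !mnmE Sl (negPf Al) addn0; case: eqVneq => // ->.
  apply/esym/eqP; rewrite eqEcard SDA cards1 lt0n cards_eq0 setD_eq0.
  apply: contra neSA => sSA.
  by rewrite eqEcard sSA (represents_card QS reprA ((reprP S).1 PS)) leqnn.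
have uniq_enumD : uniq [seq [set j] | j <- enum D].
  by rewrite map_inj_uniq ?enum_uniq //; apply: set1_inj.
(* Pigeonhole: [r] distinct singletons lie among [r] differences, so the differences are exactly
   these singletons, without repetition. *)
have size_diffs : size [seq B :\: A | B <- s] <= size [seq [set j] | j <- enum D].
  by rewrite !size_map -cardE cardD szs.
have [_ diffsE] := uniq_min_size uniq_enumD diffs_sub size_diffs.
have uniq_diffs := leq_size_uniq uniq_enumD diffs_sub size_diffs.
have mem_s S : represents Sigma Q S pi -> S != A -> S \in s.
  by rewrite sP => /reprP -> ->.
apply: (complete_intersection_of_exchanges coxW QS reprA).
- move=> S rS neSA; have : S :\: A \in [seq [set j] | j <- enum D].
    by rewrite diffsE; apply/map_f/mem_s.
  by case/mapP => j _ ->; exists j.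
- move=> S T rS rT neSA neTA eqST.
  by apply: (uniq_map_in_inj uniq_diffs) => //; apply: mem_s.
move=> i j Ai Aj rS; apply: (lex_gt_exchange Ai Aj).
(* The exchange is listed before [A], hence is lexicographically greater. *)
have /(nthP set0)[l ltl <-] := mem_s _ rS (exchange_neq _ Aj).
rewrite szs in ltl.
have ltlr := ltn_trans ltl (ltnSn r).
rewrite nth_take // -(nth_map set0 0%MM (@mesym1 n)) ?szP //.
rewrite -[mesym1 A](nth_map set0 0%MM (@mesym1 n)) ?szP //.
by apply: (sorted_ltn_nth (@lex_gt_trans n)); rewrite ?inE ?size_map ?szP.
Qed.
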